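(* Let $X\subset\mathbb{C}^{\mathbb{N}}$ be locally box-open and permutation-invariant, and let $f:X\to\mathbb{C}$ be admissibly holomorphic and $S_{\mathrm{fin}}$-invariant, i.e. $f(x\circ\sigma)=f(x)$ for all $x\in X$ and $\sigma\in S_{\mathrm{fin}}$. Let $c\in\mathbb{C}$ and let $x\in X$ be eventually constant with value $c$. Then $Df(x)[e_i]=0$ for every index $i\notin\operatorname{supp}_c(x)$.
   Context: $c_{00}$ is the space of finitely supported complex sequences indexed by $\mathbb{N}$, with supremum norm $\|\cdot\|_\infty$; $e_k$ is the sequence with $1$ in position $k$ and $0$ elsewhere. $S_{\mathrm{fin}}$ is the group of bijections $\sigma:\mathbb{N}\to\mathbb{N}$ fixing all but finitely many elements, acting on $\mathbb{C}^{\mathbb{N}}$ by $(x\circ\sigma)_n=x_{\sigma(n)}$. A subset $X\subset\mathbb{C}^{\mathbb{N}}$ is permutation-invariant if $x\circ\sigma\in X$ for all $x\in X$, $\sigma\in S_{\mathrm{fin}}$; it is locally box-open if for every $x\in X$ there is $r>0$ with $x+h\in X$ for all $h\in c_{00}$ with $\|h\|_\infty<r$. A function $f:X\to\mathbb{C}$ on such a set is admissibly holomorphic if it carries a differential datum $x\mapsto Df(x)$, where each $Df(x):c_{00}\to\mathbb{C}$ is $\mathbb{C}$-linear, such that: (i) for every $x\in X$ and $k\in\mathbb{N}$, the map $\varepsilon\mapsto f(x+\varepsilon e_k)$ is holomorphic in a neighborhood of $0\in\mathbb{C}$; (ii) for every $x\in X$ there is a constant $C_x$ with $|Df(x)[h]|\le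 C_x\|h\|_\infty$ for all $h\in c_{00}$, and $f(x+h)=f(x)+Df(x)[h]+o(\|h\|_\infty)$ as $h\to0$ in $c_{00}$ (with respect to $\|\cdot\|_\infty$). A sequence $x\in\mathbb{C}^{\mathbb{N}}$ is eventually constant with value $c$ if $x_n=c$ for all but finitely many $n$; $\operatorname{supp}_c(x)=\{n:x_n\ne c\}$ is its (finite) exceptional set. *)

(* Defs.v *)
From HB Require Import structures.
From mathcomp Require Export all_boot all_order all_algebra.
From mathcomp Require Export complex.
From mathcomp Require Export all_classical all_reals all_analysis.

Set Implicit Arguments.
Unset Strict Implicit.
Unset Printing Implicit Defensive.

Import Order.TTheory GRing.Theory Num.Theory.
Export numFieldNormedType.Exports.

Local Open Scope classical_set_scope.
Local Open Scope ring_scope.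
Local Open Scope complex_scope.

Section FinitelySupported.
Variable R : realType.
Local Notation C := R[i].
Local Notation normc := (@ComplexField.Normc.normc R).

Definition supp_at (c : C) (x : nat -> C) : set nat := [set n | x n != c].

Definition eventually_constant (c : C) (x : nat -> C) : Prop :=
  finite_set (supp_at c x).

Definition finitely_supported : {pred (nat -> C)} :=
  fun x => `[< finite_set (supp_at 0 x) >].

Record c00 := C00 {
  c00_seq :> nat -> C ;
  _ : c00_seq \in finitely_supported }.

HB.instance Definition _ := [isSub for c00_seq].
HB.instance Definition _ := [Choice of c00 by <:].

Lemma c00P (x : c00) : finite_set (supp_at 0 x).
Proof. by case: x => x /= /asboolP. Qed.

Lemma finitely_supported_submod_closed : submod_closed finitely_supported.
Proof.
split=> [|a x y]; rewrite !unfold_in.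
  apply/asboolP; suff -> : supp_at 0 (0 : nat -> C) = set0 by [].
  by apply/seteqP; split=> n //=; rewrite /supp_at/= eqxx.
move=> /asboolP fx /asboolP fy; apply/asboolP.
apply: (@sub_finite_set _ _ (supp_at 0 x `|` supp_at 0 y)).
  move=> n; rewrite /supp_at/= => axy; apply/orP; apply: contraNT axy.
  rewrite negb_or !negbK => /andP[/eqP x0 /eqP y0].
  by rewrite !fctE x0 y0 scaler0 addr0.
by rewrite finite_setU.
Qed.

HB.instance Definition _ := GRing.isSubmodClosed.Build _ _ finitely_supported
  finitely_supported_submod_closed.
HB.instance Definition _ := [SubChoice_isSubLmodule of c00 by <:].

Definition sup_norm (x : c00) : R := sup (range (fun n => normc (x n))).

Lemma normc_ge0 (z : C) : 0 <= normc z.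
Proof. by rewrite /normc; case: z => a b; exact: sqrtr_ge0. Qed.

Lemma sup_norm_has_sup (x : c00) : has_sup (range (fun n => normc (x n))).
Proof.
split; first by exists (normc (x 0%N)), 0%N.
have /finite_seqP[s sE] := c00P x.
exists (\sum_(n <- s) normc (x n)) => _ [n _ <-].
have [xn0|xn0] := eqVneq (x n) 0.
  rewrite xn0 ComplexField.Normc.normc0; apply: sumr_ge0 => i _.
  exact: normc_ge0.
have ns : n \in s by have : supp_at 0 x n by []; rewrite sE.
rewrite (big_rem n)//= lerDl; apply: sumr_ge0 => i _; exact: normc_ge0.
Qed.

Lemma sup_norm_ub (x : c00) n : normc (x n) <= sup_norm x.
Proof. by apply: ub_le_sup; [case: (sup_norm_has_sup x)|exists n]. Qed.

Lemma sup_norm_le (x : c00) (b : R) :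
  (forall n, normc (x n) <= b) -> sup_norm x <= b.
Proof.
move=> xb; apply: ge_sup; first by case: (sup_norm_has_sup x).
by move=> _ [n _ <-].
Qed.

Lemma sup_normD (x y : c00) : sup_norm (x + y) <= sup_norm x + sup_norm y.
Proof.
apply: sup_norm_le => n.
apply: (le_trans (le_normcD _ _)).
by apply: lerD; exact: sup_norm_ub.
Qed.

Lemma sup_norm_leZ (a : C) (x : c00) :
  sup_norm (a *: x) <= normc a * sup_norm x.
Proof.
apply: sup_norm_le => n; rewrite [X in normc X](_ : _ = a * x n)//.
rewrite ComplexField.Normc.normcM; apply: ler_wpM2l (sup_norm_ub x n).
exact: normc_ge0.
Qed.

Lemma sup_normZ (a : C) (x : c00) :
  sup_norm (a *: x) = normc a * sup_norm x.
Proof.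
have [->|a0] := eqVneq a 0.
  apply/eqP; rewrite eq_le sup_norm_leZ ComplexField.Normc.normc0 mul0r.
  by apply: le_trans (sup_norm_ub _ 0%N); exact: normc_ge0.
apply/eqP; rewrite eq_le sup_norm_leZ/=.
have na0 : 0 < normc a.
  rewrite lt_neqAle normc_ge0 andbT eq_sym; apply: contra a0 => /eqP.
  by move/ComplexField.Normc.eq0_normc => ->.
rewrite -ler_pdivlMl// -ComplexField.Normc.normcV.
by rewrite -{1}(scalerK a0 x); exact: sup_norm_leZ.
Qed.

Lemma sup_norm0_eq0 (x : c00) : sup_norm x = 0 -> x = 0.
Proof.
move=> x0; apply/val_inj/funext => n /=.
apply: ComplexField.Normc.eq0_normc; apply/eqP; rewrite eq_le normc_ge0 andbT.
by rewrite -x0 sup_norm_ub.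
Qed.

(* The norm of a normed space over [C] takes its values in [C]; hence the
   embedding [%:C] of the reals. *)
Let c00_norm (x : c00) : C := (sup_norm x)%:C.

Let c00_normD x y : c00_norm (x + y) <= c00_norm x + c00_norm y.
Proof. by rewrite /c00_norm -rmorphD lecR sup_normD. Qed.

Let c00_normZ (a : C) x : c00_norm (a *: x) = `|a| * c00_norm x.
Proof. by rewrite /c00_norm sup_normZ rmorphM. Qed.

Let c00_norm0_eq0 x : c00_norm x = 0 -> x = 0.
Proof. by move=> /complexI; exact: sup_norm0_eq0. Qed.

HB.instance Definition _ := Lmodule_isNormed.Build C c00
  c00_normD c00_normZ c00_norm0_eq0.

Lemma c00_normE (x : c00) : `|x| = (sup_norm x)%:C.
Proof. by []. Qed.

Lemma unit_seq_finitely_supported (k : nat) :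
  (fun n => (n == k)%:R : C) \in finitely_supported.
Proof.
rewrite unfold_in; apply/asboolP; apply: (@sub_finite_set _ _ [set k]) => //.
by move=> n; rewrite /supp_at/=; have [|_] := eqVneq n k; rewrite ?eqxx.
Qed.

Definition unit_seq (k : nat) : c00 := C00 (unit_seq_finitely_supported k).

Definition S_fin : set (nat -> nat) :=
  [set s : nat -> nat | bijective s /\ finite_set [set n | s n != n]].

Definition permutation_invariant (X : set (nat -> C)) : Prop :=
  forall (x : nat -> C) (s : nat -> nat), X x -> S_fin s -> X (x \o s).

Definition locally_box_open (X : set (nat -> C)) : Prop :=
  forall x, X x -> exists2 r : R, 0 < r &
    forall h : c00, `|h| < r%:C -> X (x + (h : nat -> C)).

(* A function on [X] is a total function whose values are used only on [X],
   and likewise for its differential datum. *)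
Definition S_fin_invariant (X : set (nat -> C)) (f : (nat -> C) -> C) : Prop :=
  forall (x : nat -> C) (s : nat -> nat), X x -> S_fin s -> f (x \o s) = f x.

(* [Df] is a differential datum making [f] admissibly holomorphic on [X].
   Differentiability of a function of one complex variable is derivability in
   the direction [1] over the field [C]. *)
Record admissibly_holomorphic (X : set (nat -> C)) (f : (nat -> C) -> C)
    (Df : (nat -> C) -> {linear c00 -> C^o}) : Prop := AdmissiblyHolomorphic {
  separately_holomorphic : forall x, X x -> forall k : nat,
    \forall z \near (0 : C^o),
      derivable (fun e : C^o => f (x + e *: (unit_seq k : nat -> C)) : C^o)
        z 1 ;
  differential_bounded : forall x, X x -> exists M : R,
    forall h : c00, `|Df x h| <= M%:C * `|h| ;
  differential_expansion : forall x, X x ->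
    (fun h : c00 => f (x + (h : nat -> C)) - f x - Df x h : C^o)
      =o_ (0 : c00) (id : c00 -> c00) }.

End FinitelySupported.

(* Main.v *)
Require Import Defs.

Set Implicit Arguments.
Unset Strict Implicit.
Unset Printing Implicit Defensive.

Import Order.TTheory GRing.Theory Num.Theory.

Local Open Scope classical_set_scope.
Local Open Scope ring_scope.
Local Open Scope complex_scope.

(** Two coordinates [i], [j] off the exceptional set are exchanged by a
    transposition that fixes [x], so [f (x + t e_i) = f (x + t e_j)] for small
    [t] and the differential takes the same value [a] on [e_i] and [e_j]. The
    sum of [N] such unit sequences has norm at most 1 and is mapped to [N a],
    so boundedness of the differential forces [a = 0]. *)

Definition transpose (i j n : nat) : nat :=
  if n == i then j else if n == j then i else n.

Lemma transposeK i j : involutive (transpose i j).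
Proof.
move=> n; rewrite /transpose; have [->|ni] := eqVneq n i.
  by rewrite eqxx; case: eqVneq.
have [->|nj] := eqVneq n j; first by rewrite eqxx.
by rewrite (negPf ni) (negPf nj).
Qed.

Lemma transpose_S_fin i j : S_fin (transpose i j).
Proof.
split; first exact: inv_bij (transposeK i j).
apply: (@sub_finite_set _ _ [set i; j]) => [n /=|]; last exact: finite_set2.
rewrite /transpose; have [|_] := eqVneq n i; first by left.
by have [|_] := eqVneq n j; [right|rewrite eqxx].
Qed.

Section Differential.
Variable R : realType.
Local Notation C := R[i].

(** Both coordinates of [x] equal [c], so the transposition leaves [x] alone and only moves the
    perturbation. *)
Lemma transpose_translate (c : C) (x : nat -> C) (i j : nat) (t : C) :
  ~ supp_at c x i -> ~ supp_at c x j ->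
  (x + (t *: unit_seq R i : c00 R)) \o transpose i j =
    x + (t *: unit_seq R j : c00 R).
Proof.
move=> /negP/negPn/eqP xi /negP/negPn/eqP xj; apply/funext => n /=.
change (x (transpose i j n) + t * (transpose i j n == i)%:R =
        x n + t * (n == j)%:R).
rewrite (can2_eq (transposeK i j) (transposeK i j)).
rewrite [transpose i j i]/transpose eqxx; congr (_ + _).
rewrite /transpose; have [->|_] := eqVneq n i; first by rewrite xi xj.
by have [->|_] := eqVneq n j; first by rewrite xi xj.
Qed.

(** The sum is the indicator sequence of the interval from [m] to [m + N], so its entries are 0 or 1
    whatever [N] is. *)
Lemma sup_norm_sum_unit_seq (m N : nat) :
  sup_norm (\sum_(m <= k < m + N) unit_seq R k) <= 1.
Proof.
apply: sup_norm_le => n.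
have -> : (\sum_(m <= k < m + N) unit_seq R k) n = (m <= n < m + N)%:R :> C.
  rewrite -[LHS]/((\val : c00 R -> (nat -> C)) _ n) raddf_sum fct_sumE /=.
  under eq_bigr do rewrite mulrb eq_sym.
  by rewrite -big_mkcond big_nat1_eq; case: ifP.
by case: (_ && _); rewrite /ComplexField.Normc.normc/= ?expr0n ?expr1n /= ?addr0
  ?sqrtr0 ?sqrtr1.
Qed.

Lemma cvg_scale0 (u : c00 R) :
  (fun t : C^o => t *: u) @ (0 : C^o) --> (0 : c00 R).
Proof. by have := @scalel_continuous C (c00 R) u 0; rewrite /continuous_at scale0r. Qed.

(** Subtracting the expansions along [t *: u] and [t *: v] cancels the values of [f] and leaves
    [t * (L u - L v) = o(t)]. *)
Lemma differential_eq (x : nat -> C) (f : (nat -> C) -> C)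
    (L : {linear c00 R -> C^o}) (u v : c00 R) :
  (fun h : c00 R => f (x + (h : nat -> C)) - f x - L h : C^o)
    =o_ (0 : c00 R) (id : c00 R -> c00 R) ->
  (\forall t \near (0 : C^o),
    f (x + (t *: u : c00 R)) = f (x + (t *: v : c00 R))) ->
  L u = L v.
Proof.
move=> /eqoP fL fuv; apply/eqP; rewrite -subr_eq0 -normr_le0.
set b : C := `|u| + `|v|.
(* The added 1 keeps the divisor positive even when [u] and [v] both vanish. *)
have b1 : 0 < b + 1 by rewrite ltr_wpDl// addr_ge0.
apply/ler_addgt0Pl => e e0; rewrite addr0.
have /fL eL : 0 < e / (b + 1) by rewrite divr_gt0.
(* The neighborhood is punctured so that [t] can be cancelled at the end. *)
have near_t : \forall t \near (0 : C^o)^', t != 0 /\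
    (f (x + (t *: u : c00 R)) = f (x + (t *: v : c00 R)) /\
    (`|f (x + (t *: u : c00 R)) - f x - L (t *: u) : C^o|
       <= e / (b + 1) * `|t *: u| /\
     `|f (x + (t *: v : c00 R)) - f x - L (t *: v) : C^o|
       <= e / (b + 1) * `|t *: v|)).
  apply: filterI; first exact: (nbhs_dnbhs_neq (0 : C^o)).
  apply: nbhs_dnbhs; apply: filterI => //.
  by apply: filterI; [exact: (cvg_scale0 u eL)|exact: (cvg_scale0 v eL)].
have [t [t0 [tuv [tu tv]]]] :=
  @filter_ex _ _ (Proper_dnbhs_numFieldType (0 : C)) _ near_t.
have t_gt0 : 0 < `|t| by rewrite normr_gt0.
rewrite -(ler_pM2l t_gt0) -[X in X <= _]normrM.
have -> : t * (L u - L v) =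
    (f (x + (t *: v : c00 R)) - f x - L (t *: v)) -
    (f (x + (t *: u : c00 R)) - f x - L (t *: u)).
  have LZ w : L (t *: w) = t * L w :> C by rewrite linearZ.
  by rewrite tuv !LZ mulrBr [RHS]addrC opprB addrA subrK.
apply: (le_trans (ler_normB _ _)).
apply: (le_trans (lerD tv tu)).
rewrite !normrZ -mulrDr -mulrDr [`|v| + _]addrC -/b mulrCA ler_pM2l//.
rewrite mulrAC ler_pdivrMr// ler_pM2l// lerDl//.
Qed.

(** A tail of indices suffices: a block of any length [N] fits beyond [m], giving [N * |a| <= M] for
    every [N]. *)
Lemma bounded_eq0 (L : {linear c00 R -> C^o}) (M : R) (m : nat) (a : C) :
  (forall h : c00 R, `|L h| <= M%:C * `|h|) ->
  (forall k, (m <= k)%N -> L (unit_seq R k) = a) -> a = 0.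
Proof.
move=> LM La; apply: ComplexField.Normc.eq0_normc; apply/eqP.
rewrite eq_le normc_ge0 andbT leNgt; apply/negP => a0.
(* The bound is moved from [R[i]], where norms take their values, to [R], where the Archimedean
   argument runs. *)
have LMr h : ComplexField.Normc.normc (L h) <= M * sup_norm h.
  by rewrite -lecR rmorphM; exact: LM.
(* A negative [M] would make the bound at [unit_seq R m] nonpositive, against [|a| > 0]. *)
have M0 : 0 <= M.
  have := LMr (unit_seq R m); rewrite La// leNgt; apply: contraNT.
  rewrite -ltNge => M0; apply: le_lt_trans a0; rewrite nmulr_rle0//.
  exact: le_trans (normc_ge0 _) (sup_norm_ub _ 0%N).
have le N : ComplexField.Normc.normc a *+ N <= M.
  have := LMr (\sum_(m <= k < m + N) unit_seq R k).
  rewrite linear_sum (@eq_big_nat _ _ _ _ _ _ (fun=> a)); last first.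
    by move=> k /andP[mk _]; exact: La.
  rewrite sumr_const_nat addKn normcMn.
  move/le_trans; apply; rewrite ler_piMr//.
  exact: sup_norm_sum_unit_seq.
(* This [N] exceeds [M / |a|]. *)
have := le (Num.bound (M / ComplexField.Normc.normc a)).
rewrite leNgt -mulr_natl -ltr_pdivrMr// => /negP; apply.
by rewrite archi_boundP// divr_ge0// ltW.
Qed.

End Differential.

Theorem proposition3p4 (R : realType) (X : set (nat -> R[i]))
    (f : (nat -> R[i]) -> R[i])
    (Df : (nat -> R[i]) -> {linear c00 R -> R[i]^o})
    (X_open : locally_box_open X) (X_perm : permutation_invariant X)
    (f_hol : admissibly_holomorphic X f Df)
    (f_inv : S_fin_invariant X f)
    (c : R[i]) (x : nat -> R[i]) (Xx : X x)
    (x_const : eventually_constant c x) (i : nat) :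
  ~ supp_at c x i -> Df x (unit_seq R i) = 0.
Proof.
move=> xi; have [r r0 rX] := X_open _ Xx.
have [m xm] : exists m, forall k, (m <= k)%N -> ~ supp_at c x k.
  have /finite_seqP[s sE] := x_const.
  (* One past the largest exceptional index. *)
  exists (\max_(k <- s) k).+1 => k mk; rewrite sE /= => ks.
  by move: mk; rewrite ltnNge leq_bigmax_seq.
have [M DM] := differential_bounded f_hol Xx.
(* Here [a] is [Df x (unit_seq R i)] itself; each [k] beyond [m] is compared with the given [i]. *)
apply: (bounded_eq0 DM (m := m)) => k /xm xk.
apply: (differential_eq (differential_expansion f_hol Xx)).
(* Invariance of [f] holds only on [X], so [t] is kept small enough for the translate to stay in the
   box around [x]. *)
have /cvgr0_norm_lt/(_ r%:C) := @cvg_scale0 R (unit_seq R k); rewrite ltcR => /(_ r0).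
apply: filterS => t /rX Xt.
by rewrite -(transpose_translate t xk xi) f_inv//; exact: transpose_S_fin.
Qed.
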